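(* Let $X$ be a second countable locally compact Hausdorff space, let $Y$ be a Hausdorff topological space, and let $q:X\to Y$ be a quotient map. The following are equivalent for a point $y\in Y$: (i) the quotient map $q$ is biquotient at $y$; (ii) $y$ has a compact neighbourhood in $Y$; (iii) $y$ has a countable basis of neighbourhoods in $Y$.
   Context: A quotient map $q:X\to Y$ is a surjection such that $U\subseteq Y$ is open if and only if $q^{-1}(U)$ is open in $X$. A map $q:X\to Y$ is called biquotient at $y\in Y$ if every cover of $q^{-1}(y)$ by open subsets of $X$ has a finite subfamily $\mathcal{V}$ such that $y\in \mathrm{Int}\left(\bigcup\{q(U)\mid U\in\mathcal{V}\}\right)$, where $\mathrm{Int}$ denotes the interior in $Y$. *)

(* Defs.v *)
From HB Require Import structures.
From mathcomp Require Import all_boot all_order all_algebra.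
From mathcomp Require Import all_classical topology.

Set Implicit Arguments.
Unset Strict Implicit.
Unset Printing Implicit Defensive.

Local Open Scope classical_set_scope.

Definition quotient_map (X Y : topologicalType) (q : X -> Y) : Prop :=
  set_surj [set: X] [set: Y] q /\
  forall U : set Y, open U <-> open (q @^-1` U).

Definition biquotient_at (X Y : topologicalType) (q : X -> Y) (y : Y) : Prop :=
  forall C : set (set X),
    C `<=` open -> q @^-1` [set y] `<=` \bigcup_(U in C) U ->
    exists V : set (set X),
      [/\ finite_set V, V `<=` C & (\bigcup_(U in V) (q @` U))° y].

(* Neighbourhoods are not required to be open, as with the library's nbhs. *)
Definition compact_nbhs_at (Y : topologicalType) (y : Y) : Prop :=
  exists2 K : set Y, nbhs y K & compact K.

Definition countable_nbhs_basis_at (Y : topologicalType) (y : Y) : Prop :=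
  exists B : set (set Y),
    [/\ countable B, B `<=` nbhs y &
        forall W : set Y, nbhs y W -> exists2 N : set Y, B N & N `<=` W].

(* Main.v *)
(* (i) => (ii): finitely many compact sets closure U have images whose union is
   a neighbourhood of y.
   (ii) => (iii): the images of a countable basis of X form a countable network
   of Y, which yields open sets V_n covering Y minus y whose closures miss y; if
   K is a compact neighbourhood of y, the sets K minus the closures of
   V_0, ..., V_(n-1) form a basis at y, by compactness of K.
   (iii) => (i): let U_0, U_1, ... be a countable subcover of the fibre and
   B_0, B_1, ... a decreasing basis at y. If no finite union of the q(U_i) is a
   neighbourhood of y, pick u_n in B_n outside q(U_0), ..., q(U_(n-1)). Then u_n
   converges to y, but every point of X has a neighbourhood whose image contains
   only finitely many terms of u, so a tail of u avoiding y is closed in the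
   quotient topology, a contradiction. *)

Require Import Defs.
From mathcomp Require Import all_boot all_order all_algebra.
From mathcomp Require Import all_classical topology.

Local Open Scope classical_set_scope.

Lemma countable_range (T : Type) (D : set T) :
  countable D -> D !=set0 -> exists f : nat -> T, range f = D.
Proof.
move=> /pfcard_geP[->|[f]] [x Dx] //.
exists f; rewrite eqEsubset; split; last exact: surj.
by move=> _ [n _ <-]; exact: funS.
Qed.

Lemma filter_bigcap_II (T : Type) (F : set_system T) (N : nat -> set T) n :
  Filter F -> (forall i, F (N i)) -> F (\bigcap_(i < n) N i).
Proof.
move=> FF FN; elim: n => [|n IHn].
  by rewrite II0 bigcap_set0; exact: filterT.
by rewrite IIS bigcap_setU bigcap_set1; exact: filterI.
Qed.

Lemma second_countable_seq (X : topologicalType) : @second_countable X ->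
  exists b : nat -> set X, forall x W, nbhs x W ->
    exists n, [/\ open (b n), b n x & b n `<=` W].
Proof.
move=> [B cB [oB bB]].
have [B0|/set0P/(countable_range _ _ cB)[b bE]] := eqVneq B set0.
  (* An empty basis leaves [X] without points, so any sequence serves. *)
  by exists (fun=> set0) => x W /bB[U []]; rewrite B0.
exists b => x W /bB[U [BU Ux] UW].
have : range b U by rewrite bE.
by move=> [n _ bn]; exists n; rewrite bn; split=> //; exact: oB.
Qed.

(** Lindelöf argument: for each basic open set lying in some member of [C], one such member is kept;
    a point of [A] provides the default [U0] for the other indices. *)
Lemma second_countable_subcover (X : topologicalType) (A : set X)
    (C : set (set X)) :
  @second_countable X -> A !=set0 -> C `<=` open -> A `<=` \bigcup_(U in C) U ->
  exists U : nat -> set X, (forall n, C (U n)) /\ A `<=` \bigcup_n U n.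
Proof.
move=> /second_countable_seq[b bb] [x0 Ax0] oC AC.
have [U0 CU0 _] := AC _ Ax0.
have /choice[U UP] n : exists U, C U /\
    forall U', C U' -> b n `<=` U' -> b n `<=` U.
  have [[U CU bU]|nU] := pselect (exists2 U, C U & b n `<=` U).
    by exists U.
  by exists U0; split=> // U' CU' bU'; case: nU; exists U'.
exists U; split=> [n|x /AC[U' CU' U'x]]; first by case: (UP n).
have [|n [_ bnx bnU']] := bb x U'; first by apply: open_nbhs_nbhs; split=> //; exact: oC.
by exists n => //; have [_ /(_ _ CU' bnU')] := UP n; exact.
Qed.

Lemma quotient_map_continuous (X Y : topologicalType) (q : X -> Y) :
  quotient_map q -> continuous q.
Proof. by move=> [_ qo]; apply/continuousP => U /qo. Qed.

Lemma quotient_map_surj (X Y : topologicalType) (q : X -> Y) :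
  quotient_map q -> forall y, exists x, q x = y.
Proof. by move=> [+ _] y => /(_ y I)[x _ <-]; exists x. Qed.

Lemma biquotient_compact_nbhs (X Y : topologicalType) (q : X -> Y) (y : Y) :
  locally_compact [set: X] -> continuous q ->
  biquotient_at q y -> compact_nbhs_at y.
Proof.
move=> lcX qc qy.
have [||V [Vfin VC yV]] := qy [set U | open U /\ precompact U].
- by move=> U [].
- move=> x _; have [K] := lcX x I; rewrite withinET => xK [cK clK].
  exists K°; last exact: xK.
  split; first exact: open_interior.
  by exists K; [exact: interior_subset|].
exists (\bigcup_(U in V) (q @` closure U)).
  apply: filterS yV => z [U VU [x Ux <-]].
  by exists U => //; exists x => //; exact: subset_closure.
rewrite -bigsetU_fset_set// big_seq; apply: bigsetU_compact => U.
rewrite in_fset_set// inE => /VC[_]; rewrite precompactE => cU.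
exact/continuous_compact/cU/continuous_subspaceT.
Qed.

(* The sets [q @` U], for [U] in a countable basis of [X], form a countable
   network of [Y]; each of those that can be separated from [y] is enlarged to
   an open set whose closure misses [y]. *)
Lemma hausdorff_image_open_seq (X Y : topologicalType) (q : X -> Y) (y : Y) :
  @second_countable X -> hausdorff_space Y -> continuous q ->
  (forall z, exists x, q x = z) ->
  exists V : nat -> set Y, [/\ forall n, open (V n),
    forall n, nbhs y (~` closure (V n)) & forall z, z <> y -> exists n, V n z].
Proof.
move=> /second_countable_seq[b bb]; rewrite open_hausdorff => hY qc qs.
pose sep V := open V /\ nbhs y (~` closure V).
have /choice[V VP] n : exists V, sep V /\
    forall V', sep V' -> q @` b n `<=` V' -> q @` b n `<=` V.
  have [[V sV bV]|nV] := pselect (exists2 V, sep V & q @` b n `<=` V).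
    by exists V.
  exists set0; split; last by move=> V' sV' bV'; case: nV; exists V'.
  by split; [exact: open0|rewrite closure0 setC0; exact: filterT].
exists V; split=> [n|n|z /eqP/hY[[P Q] /= [/set_mem Pz /set_mem Qy]]].
- by case: (VP n) => -[].
- by case: (VP n) => -[].
- move=> [oP oQ /eqP PQ].
  (* The open set [Q] around [y] is disjoint from [P], hence from its closure. *)
  have sP : sep P.
    split=> //; apply: (@filterS _ _ _ Q); last exact: open_nbhs_nbhs.
    move=> t Qt /(_ Q (open_nbhs_nbhs (conj oQ Qt))) [s PQs].
    by rewrite PQ in PQs.
  have [x qx] := qs z.
  have [|n [_ bnx bnP]] := bb x (q @^-1` P).
    by apply: qc; rewrite qx; exact: open_nbhs_nbhs.
  exists n; have [_ /(_ _ sP)] := VP n; apply; last by exists x.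
  by move=> _ [x' /bnP ? <-].
Qed.

Lemma compact_nbhs_countable_basis (X Y : topologicalType) (q : X -> Y)
    (y : Y) :
  @second_countable X -> hausdorff_space Y -> continuous q ->
  (forall z, exists x, q x = z) ->
  compact_nbhs_at y -> countable_nbhs_basis_at y.
Proof.
move=> scX hY qc qs [K yK cK].
have [V [oV yV Vy]] := hausdorff_image_open_seq X Y q y scX hY qc qs.
pose B n := K `&` \bigcap_(i < n) ~` closure (V i).
exists (range B); split.
- exact: sub_countable (card_image_le _ _) (countableP _).
- by move=> _ [n _ <-]; apply: filterI => //; exact: filter_bigcap_II.
- move=> W; rewrite nbhsE => -[O [oO Oy] OW].
  (* By the near-covering form of compactness, it suffices to treat [n] large and points near a
     given [z] in [K]: if [z] is outside [O], some [V k] contains it, and [B n] misses [V k] once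
     [k < n]. *)
  have : \forall n \near \oo, K `<=` [set z | B n z -> O z].
    apply: (compact_near_coveringP K).1 cK _ _ _ _ _ => z Kz.
    have [Oz|nOz] := pselect (O z).
      exists (O, setT) => [|[z' n] [/= Oz' _] _ //].
      by split; [exact: open_nbhs_nbhs|exact: filterT].
    have [|k Vkz] := Vy z; first by move=> zy; rewrite zy in nOz.
    exists (V k, [set n | (k < n)%N]).
      by split; [exact: open_nbhs_nbhs (conj (oV k) Vkz)|exists k.+1].
    move=> [z' n] [/= Vz' kn] [_ /(_ k kn)] []; exact: subset_closure.
  move=> [n _ /(_ n (leqnn n)) nO]; exists (B n); first by exists n.
  by move=> z Bz; apply/OW/nO => //; case: Bz.
Qed.

Lemma countable_basis_biquotient (X Y : topologicalType) (q : X -> Y) (y : Y) :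
  @second_countable X -> hausdorff_space Y -> quotient_map q ->
  countable_nbhs_basis_at y -> biquotient_at q y.
Proof.
move=> scX hY qq [B [cB By yB]] C oC fC.
have qc := quotient_map_continuous X Y q qq.
have [x0 qx0] := quotient_map_surj X Y q qq y.
have [N NE] : exists N : nat -> set Y, range N = B.
  by apply: countable_range => //; have [N] := yB _ filterT; exists N.
have [|U [CU fU]] := second_countable_subcover X (q @^-1` [set y]) C scX _ oC fC.
  by exists x0.
apply: contrapT => noV.
(* Otherwise the neighbourhood [\bigcap_(i < n) N i] of [y] would lie in the union of the first [n]
   images, against [noV]. *)
have /choice[u uP] n : exists z, (\bigcap_(i < n) N i) z /\
    forall i, (i < n)%N -> ~ (q @` U i) z.
  apply: contrapT => nz; apply: noV; exists (U @` `I_n); split.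
  - exact: finite_image.
  - by move=> _ [i _ <-].
  - apply: (@filterS _ _ _ (\bigcap_(i < n) N i)).
      move=> z Nz; apply: contrapT => nUz; apply: nz; exists z; split=> // i i_n Uz.
      by apply: nUz; exists (U i) => //; exists i.
    by apply: filter_bigcap_II => i; apply: By; rewrite -NE; exists i.
have ucvg W : nbhs y W -> exists n, forall m, (n <= m)%N -> W (u m).
  move=> /yB[N']; rewrite -NE => -[n _ <-] NW; exists n.+1 => m nm.
  by apply: NW; case: (uP m) => + _; exact.
(* Since [y = q x0] lies in the image of [U k], the terms of [u] past [k] differ from [y]. *)
have [k _ Ukx0] := fU x0 qx0.
have uNy n : (k < n)%N -> u n <> y.
  by move=> kn uy; case: (uP n) => _ /(_ _ kn); apply; exists x0; rewrite ?uy.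
pose T := ~` (u @` [set n | (k < n)%N]).
have oT : open T.
  apply/qq.2; rewrite openE => x Tx.
  (* Over [y], some [U n] serves as [O]; elsewhere, [q x] is separated from the limit [y] of [u]. *)
  have [n [O xO Ou]] : exists n, exists2 O, nbhs x O &
      forall i, (n <= i)%N -> ~ (q @` O) (u i).
    have [qxy|/eqP qxy] := pselect (q x = y).
      have [n _ Unx] := fU x qxy.
      exists n.+1, (U n); last by move=> i ni; case: (uP i) => _; exact.
      by apply: open_nbhs_nbhs; split=> //; exact: oC.
    move: hY; rewrite open_hausdorff => /(_ _ _ qxy)[[P Q] /= [/set_mem Px /set_mem Qy]].
    move=> [oP oQ /eqP PQ].
    have [|n nQ] := ucvg Q; first exact: open_nbhs_nbhs.
    exists n, (q @^-1` P); first by apply: qc; exact: open_nbhs_nbhs.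
    move=> i /nQ Qi [x' Px' x'i]; rewrite -x'i in Qi.
    by have : (P `&` Q) (q x') by []; rewrite PQ.
  (* The tail terms that [O] may still meet are finite in number, so they form a closed set, which
     misses [q x]. *)
  pose F := u @` [set i | (i < n)%N /\ (k < i)%N].
  have cF : closed F.
    apply: (accessible_finite_set_closed.1 (hausdorff_accessible hY)).
    by apply/finite_image/(sub_finite_set _ (finite_II n)) => i [].
  have xF : nbhs x (q @^-1` (~` F)).
    apply: qc; apply: open_nbhs_nbhs; split; first exact: closed_openC.
    by move=> [i [_ ki] uix]; apply: Tx; exists i.
  apply: filterS (filterI xO xF) => x' [Ox' nFx'] [i ki uix'].
  have [ni|i_n] := leqP n i; first by apply: (Ou i ni); exists x'.
  by apply: nFx'; exists i.
have [|n nT] := ucvg T.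
  by apply: open_nbhs_nbhs; split=> // -[i ki]; exact: uNy.
(* This index is late enough for [u] to be in [T], yet belongs to the tail removed from [T]. *)
by apply: (nT (maxn n k.+1)); [exact: leq_maxl|exists (maxn n k.+1) => //=; exact: leq_maxr].
Qed.

Theorem theorem4 (X Y : topologicalType) (q : X -> Y)
    (X_second_countable : @second_countable X)
    (X_locally_compact : locally_compact [set: X])
    (X_hausdorff : hausdorff_space X)
    (Y_hausdorff : hausdorff_space Y)
    (q_quotient : quotient_map q)
    (y : Y) :
  [<-> biquotient_at q y; compact_nbhs_at y; countable_nbhs_basis_at y].
Proof.
have qc := quotient_map_continuous X Y q q_quotient.
have qs := quotient_map_surj X Y q q_quotient.
tfae.
- exact: biquotient_compact_nbhs.
- exact: compact_nbhs_countable_basis qs.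
- exact: countable_basis_biquotient.
Qed.
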